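(* Let $X$, $X_1$ and $X_2$ be real-valued random variables on a common probability space with finite variances, and let $X(X_1,X_2) := \min(X_2, \max(X,X_1))$ (pointwise). Then $$\mathrm{Var}(X(X_1,X_2)) = \mathrm{Var}(X_2) + \mathrm{Var}(X_1) + \mathrm{Var}(X)$$ if and only if, for some real constants $c_1$ and $c_2$, one of the following sets of conditions holds: (1) $c_2 = X_2 \ge X \ge X_1 = c_1$ almost surely; (2) $c_2 = X \ge X_1 = c_1$ almost surely and $c_2 = X \ge X_2$ almost surely; (3) $c_2 = X_2 \ge X_1 \ge X = c_1$ almost surely; (4) $c_2 = X_1 \ge X = c_1$ almost surely and $c_2 = X_1 \ge X_2$ almost surely.
   Context: The notation $X(X_1,X_2)$ denotes the truncation of $X$ by $X_2$ from above and by $X_1$ from below; no independence, common distribution, or ordering of $X$, $X_1$, $X_2$ is assumed. Finite variance means finite second moment (square-integrable). *)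

(* Defs.v *)
From mathcomp Require Import all_boot all_order all_algebra.
From mathcomp Require Import all_classical all_reals all_analysis.

Set Implicit Arguments.
Unset Strict Implicit.
Unset Printing Implicit Defensive.

Import Order.TTheory GRing.Theory Num.Theory.

Local Open Scope ring_scope.

(* Since X1 <= X2 is not assumed, the order of the two operations matters:
   where X2 < X1 the truncation is equal to X2. *)
Definition truncation (T : Type) (R : realType) (X X1 X2 : T -> R) : T -> R :=
  fun w => Num.min (X2 w) (Num.max (X w) (X1 w)).

(* Main.v *)
Require Import Defs.
From mathcomp Require Import all_boot all_order all_algebra.
From mathcomp Require Import all_classical all_reals all_analysis.
From mathcomp Require Import measurable_realfun lra.

Set Implicit Arguments.
Unset Strict Implicit.
Unset Printing Implicit Defensive.

Import Order.TTheory GRing.Theory Num.Theory.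

Local Open Scope ring_scope.

(** Write M for the truncation of X between Y and Z, and primes for an
    independent copy.  Since min and max are 1-Lipschitz for the sup norm,
    (M - M')^2 is at most one of (X - X')^2, (Y - Y')^2, (Z - Z')^2, hence at
    most their sum ([sqr_truncationB_le]).  As Var U = E[(U - U')^2] / 2, the
    variances add up exactly when (M - M')^2 is almost surely equal to that
    sum ([variance_sum_ae_pairs]).  No product measure is needed: the
    expectation of (U - a)^2 is an explicit polynomial in a, so integrating
    over one copy with the other one fixed, and then over the other, gives
    almost every w' for almost every w.

    In the equality case at least two of the differences X - X', Y - Y',
    Z - Z' vanish for almost all pairs.  If the union of two equivalence
    relations is total then one of the two is total; the almost sure version
    of this fact ([ae_pairs_cst]), applied to the three pairs of variables,
    shows that two of the three variables are constant.  The remaining one,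
    U, satisfies |M - M'| = |U - U'|; a value of U strictly beyond one of the
    constant bounds moves strictly less after truncation than before, so
    either U stays within the bounds, which yields one of the four cases, or
    U is constant too ([ae_out_cst]), and then the order of the three
    constants selects a case.  Conversely, in each case M is almost surely
    equal to one of the variables and the other two are constant. *)

(** * Expectations of squares and variances *)

Section square_integrable.
Context d (T : measurableType d) (R : realType) (P : probability T R).
Implicit Types f g : T -> R.

Lemma Lfun2_measurable f : f \in Lfun P 2%:E -> measurable_fun setT f.
Proof. by move=> /sub_Lfun_mfun; rewrite inE. Qed.

Lemma integrable_sqr_Lfun2 f : measurable_fun setT f ->
  P.-integrable setT (EFin \o (fun w => f w ^+ 2)) -> f \in Lfun P 2%:E.
Proof.
move=> mf /integrableP[_ f2]; apply/andP; split; rewrite inE//=.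
rewrite /finite_norm unlock poweR_lty//.
apply: le_lt_trans f2; rewrite le_eqVlt; apply/orP; left; apply/eqP.
by apply: eq_integral => w _ /=; rewrite powR_mulrn// normrX.
Qed.

Lemma Lfun2_sqrB f a : f \in Lfun P 2%:E ->
  (fun w => (f w - a) ^+ 2) \in Lfun P 1.
Proof.
move=> f2; have fa : (f \- cst a)%R \in Lfun P 2%:E.
  by rewrite rpredB ?lee1n//= Lfun_cst.
exact: (Lfun2_mul_Lfun1 fa fa).
Qed.

(** The second moment about [a]: this is what makes the integral over one
    copy of the probability space explicit as a function of the other. *)
Lemma expectation_sqrB f a : f \in Lfun P 2%:E ->
  'E_P[(fun w => (f w - a) ^+ 2)%R]%E
  = (fine 'V_P[f] + (fine 'E_P[f] - a) ^+ 2)%:E.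
Proof.
move=> f2.
have f1 : f \in Lfun P 1 by rewrite Lfun_subset12 ?fin_num_measure.
have fa : (f \- cst a)%R \in Lfun P 2%:E.
  by rewrite rpredB ?lee1n//= Lfun_cst.
have := varianceE fa.
rewrite varianceB_cst_r// expectationB ?Lfun_cst// expectation_cst.
rewrite EFinD EFin_expe EFinB !fineK ?variance_fin_num ?expectation_fin_num//.
move=> ->; rewrite subeK//.
by rewrite -(fineK (expectation_fin_num f1)) -EFinB -EFin_expe.
Qed.

(** A nonnegative random variable of zero mean vanishes almost surely. *)
Lemma ge0_expectation_eq0 f : f \in Lfun P 1 -> (forall w, 0 <= f w) ->
  'E_P[f]%E = 0%E -> {ae P, forall w, f w = 0}.
Proof.
move=> f1 f0; rewrite unlock => Ef.
have mf := measurable_int P ((Lfun1_integrable P f).1 f1).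
have /(ae_eq_integral_abs P measurableT mf) : (\int[P]_w `|(f w)%:E| = 0)%E.
  by rewrite -[RHS]Ef; apply: eq_integral => w _; rewrite gee0_abs ?lee_fin.
by apply: filterS => w /(_ I) [].
Qed.

Section pairs.
Context (M X Y Z : T -> R).
Hypotheses (M2 : M \in Lfun P 2%:E) (X2 : X \in Lfun P 2%:E)
  (Y2 : Y \in Lfun P 2%:E) (Z2 : Z \in Lfun P 2%:E).

Let sq f a : T -> R := fun w => (f w - a) ^+ 2.

(* [D m x y z] is the deficit in the pointwise inequality at a pair of points, as
   a function of one of them, when M, X, Y, Z take the values m, x, y, z at the
   other. *)
Let D m x y z : T -> R := sq X x \+ sq Y y \+ sq Z z \- sq M m.

Let sq_Lfun1 f a : f \in Lfun P 2%:E -> sq f a \in Lfun P 1.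
Proof. exact: Lfun2_sqrB. Qed.

Let D_Lfun1 m x y z : D m x y z \in Lfun P 1.
Proof. by rewrite rpredB//= ?rpredD//= ?sq_Lfun1. Qed.

Let expectation_D m x y z : 'E_P[D m x y z]%E =
  (fine 'V_P[X]%E + fine 'V_P[Y]%E + fine 'V_P[Z]%E - fine 'V_P[M]%E
   + ((fine 'E_P[X]%E - x) ^+ 2 + (fine 'E_P[Y]%E - y) ^+ 2
      + (fine 'E_P[Z]%E - z) ^+ 2 - (fine 'E_P[M]%E - m) ^+ 2))%:E.
Proof.
rewrite expectationB ?expectationD//= ?rpredD//= ?sq_Lfun1//.
rewrite !expectation_sqrB// -!(EFinB, EFinD); congr EFin; lra.
Qed.

(** If the squared differences of M are at most the sum of those of X, Y, Z,
    integration over pairs shows that the variance of M is at most the sum of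
    the three variances; this is the equality case. *)
Lemma variance_sum_ae_pairs :
  (forall w w', (M w - M w') ^+ 2 <=
     (X w - X w') ^+ 2 + (Y w - Y w') ^+ 2 + (Z w - Z w') ^+ 2) ->
  ('V_P[M] = 'V_P[X] + 'V_P[Y] + 'V_P[Z])%E ->
  {ae P, forall w, {ae P, forall w', (M w - M w') ^+ 2 =
     (X w - X w') ^+ 2 + (Y w - Y w') ^+ 2 + (Z w - Z w') ^+ 2}}.
Proof.
move=> le_pairs VM.
have V0 : fine 'V_P[X]%E + fine 'V_P[Y]%E + fine 'V_P[Z]%E - fine 'V_P[M]%E = 0.
  by rewrite VM !fineD ?fin_numD ?variance_fin_num// subrr.
(* Once the variances cancel, the expectation of the deficit for a fixed
   point [w] is the deficit at [w] relative to the four means, whose own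
   expectation is zero. *)
pose H := D (fine 'E_P[M]%E) (fine 'E_P[X]%E) (fine 'E_P[Y]%E) (fine 'E_P[Z]%E).
have HE w : 'E_P[D (M w) (X w) (Y w) (Z w)]%E = (H w)%:E.
  by rewrite expectation_D V0 /H /D /sq /=; congr EFin; lra.
have D_ge0 w w' : 0 <= D (M w) (X w) (Y w) (Z w) w'.
  by rewrite /D /sq /=; have := le_pairs w' w; lra.
have : {ae P, forall w, H w = 0}.
  apply: ge0_expectation_eq0; first exact: D_Lfun1.
    by move=> w; rewrite -lee_fin -HE expectation_ge0.
  by rewrite expectation_D V0 !subrr expr0n/= oppr0 !addr0.
apply: filterS => w Hw.
have : {ae P, forall w', D (M w) (X w) (Y w) (Z w) w' = 0}.
  by apply: (ge0_expectation_eq0 (D_Lfun1 _ _ _ _)) => //; rewrite HE Hw.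
by apply: filterS => w'; rewrite /D /sq /=; lra.
Qed.

End pairs.

Lemma variance_ae_eq f g : measurable_fun setT f -> measurable_fun setT g ->
  {ae P, forall w, f w = g w} -> 'V_P[f]%E = 'V_P[g]%E.
Proof.
move=> mf mg fg.
have E_eq h k : measurable_fun setT h -> measurable_fun setT k ->
    {ae P, forall w, h w = k w} -> 'E_P[h]%E = 'E_P[k]%E.
  move=> mh mk hk; rewrite unlock; apply: ae_eq_integral => //.
  - exact/measurable_EFinP.
  - exact/measurable_EFinP.
  - by apply: filterS hk => w ->.
rewrite /variance unlock (E_eq f g)//; apply: E_eq.
- by apply: measurable_funM; exact: measurable_funB.
- by apply: measurable_funM; exact: measurable_funB.
- by apply: filterS fg => w /= fgw; rewrite !fctE/= fgw.
Qed.

Lemma variance_ae_cst f c : measurable_fun setT f ->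
  {ae P, forall w, f w = c} -> 'V_P[f]%E = 0%E.
Proof.
by move=> mf fc; rewrite (variance_ae_eq (g := cst c)) ?variance_cst.
Qed.

(** * Almost sure constancy *)

(** [f] is almost surely equal to some constant. *)
Definition ae_cst f := exists c, {ae P, forall w, f w = c}.

Lemma not_ae_ex (A B : T -> Prop) : ~ {ae P, forall w, A w} ->
  {ae P, forall w, B w} -> exists2 w, B w & ~ A w.
Proof.
move=> nA aB; apply: contrapT => nex; apply: nA; apply: filterS aB => w Bw.
by apply: contrapT => nAw; apply: nex; exists w.
Qed.

(** Almost sure version of: if the union of two equivalence relations (here,
    having the same value under [f], or under [g]) is total, one is total. *)
Lemma ae_pairs_cst f g :
  {ae P, forall w, {ae P, forall w', f w = f w' \/ g w = g w'}} ->
  ae_cst f \/ ae_cst g.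
Proof.
move=> fg; apply: contrapT => /not_orP[nf ng].
have nfc c : ~ {ae P, forall w, f w = c} by move=> fc; apply: nf; exists c.
have ngc c : ~ {ae P, forall w, g w = c} by move=> gc; apply: ng; exists c.
(* [w1] shares with [w0] its value under [f] but not under [g], and [w2] the
   other way round; then [w1] and [w2] share neither value.  The constant 0
   is arbitrary: it only serves to find some point [w0]. *)
have [w0 fgw0 _] := not_ae_ex (nfc 0) fg.
have [w1 [fgw1 [f01|g01]] ng01] :=
  not_ae_ex (ngc (g w0)) (filterI fg fgw0); last by rewrite g01 in ng01.
have [w2 [fgw02 fgw12]] := not_ae_ex (nfc (f w0)) (filterI fgw0 fgw1).
case: fgw02 => [-> //|g02] nf02; case: fgw12 => [f12|g12].
  by apply: nf02; rewrite -f12.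
by apply: ng01; rewrite g12.
Qed.

(** If almost every point outside [A] has almost surely the same value under
    [f] as the other points, a single such point makes [f] constant. *)
Lemma ae_out_cst f (A : T -> Prop) :
  {ae P, forall w, A w \/ {ae P, forall w', f w = f w'}} ->
  {ae P, forall w, A w} \/ ae_cst f.
Proof.
move=> Af; have [|/not_ae_ex/(_ Af)[w [//|fw] _]] :=
  pselect {ae P, forall w, A w}; first by left.
by right; exists (f w); apply: filterS fw => w' ->.
Qed.

End square_integrable.

(** * Contraction properties of the truncation *)

Section truncation_sqrB.
Context (R : realType).
Implicit Types x y z : R.

(** 1-Lipschitz continuity for the sup norm, stated as an alternative so that
    the equality case tells which differences vanish. *)
Lemma sqr_maxB_le x y x' y' :
  (Num.max x y - Num.max x' y') ^+ 2 <= (x - x') ^+ 2 \/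
  (Num.max x y - Num.max x' y') ^+ 2 <= (y - y') ^+ 2.
Proof.
have [yx|xy] := leP y x; have [y'x'|x'y'] := leP y' x'; [by left| | |by right].
- by have [?|?] := leP x y'; [right|left]; nra.
- by have [?|?] := leP y x'; [left|right]; nra.
Qed.

Lemma sqr_minB_le x y x' y' :
  (Num.min x y - Num.min x' y') ^+ 2 <= (x - x') ^+ 2 \/
  (Num.min x y - Num.min x' y') ^+ 2 <= (y - y') ^+ 2.
Proof.
have [xy|yx] := leP x y; have [x'y'|y'x'] := leP x' y'; [by left| | |by right].
- by have [?|?] := leP x y'; [left|right]; nra.
- by have [?|?] := leP y x'; [right|left]; nra.
Qed.

(** Clamping to the interval from [y] to [z] (possibly empty) strictly
    decreases the distance from a point outside it to any other point. *)
Lemma clamp_out_eq x x' y z : ~~ (y <= x <= z) ->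
  (Num.min z (Num.max x y) - Num.min z (Num.max x' y)) ^+ 2 = (x - x') ^+ 2 ->
  x = x'.
Proof.
rewrite negb_and => out /eqP; rewrite eqf_sqr => eq_dist.
by move: out eq_dist; repeat (case: leP => ?);
  move=> /orP[//?|//?] /orP[/eqP ?|/eqP ?]; lra.
Qed.

(** The same for a bound from above only. *)
Lemma min_out_eq z z' m : m < z ->
  (Num.min z m - Num.min z' m) ^+ 2 = (z - z') ^+ 2 -> z = z'.
Proof.
move=> mz /eqP; rewrite eqf_sqr.
have [?|?] := leP z m; have [?|?] := leP z' m.
all: by move=> /orP[/eqP ?|/eqP ?]; lra.
Qed.

End truncation_sqrB.

(** * The variance of the truncation *)

Section truncation_probability.
Context d (T : measurableType d) (R : realType) (P : probability T R).
Implicit Types X Y Z : T -> R.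

Lemma truncationC X Y Z : truncation X Y Z = truncation Y X Z.
Proof. by apply/funext => w; rewrite /truncation maxC. Qed.

Lemma sqr_truncationB_le X Y Z w w' : let t := truncation X Y Z in
  [\/ (t w - t w') ^+ 2 <= (X w - X w') ^+ 2,
      (t w - t w') ^+ 2 <= (Y w - Y w') ^+ 2 |
      (t w - t w') ^+ 2 <= (Z w - Z w') ^+ 2].
Proof.
rewrite /truncation /=.
have [le_Z|le_max] := sqr_minB_le (Z w) (Num.max (X w) (Y w)) (Z w')
  (Num.max (X w') (Y w')); first by constructor 3.
have [le_X|le_Y] := sqr_maxB_le (X w) (Y w) (X w') (Y w').
- by apply: Or31; exact: le_trans le_max le_X.
- by apply: Or32; exact: le_trans le_max le_Y.
Qed.

Lemma sqr_truncation_le X Y Z w :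
  truncation X Y Z w ^+ 2 <= X w ^+ 2 + Y w ^+ 2 + Z w ^+ 2.
Proof.
rewrite /truncation; have [_|_] := leP (Z w); last have [_|_] := leP (X w);
  nra.
Qed.

Lemma measurable_truncation X Y Z : measurable_fun setT X ->
  measurable_fun setT Y -> measurable_fun setT Z ->
  measurable_fun setT (truncation X Y Z).
Proof.
by move=> mX mY mZ; apply: measurable_minr => //; exact: measurable_maxr.
Qed.

Lemma Lfun2_truncation X Y Z : X \in Lfun P 2%:E -> Y \in Lfun P 2%:E ->
  Z \in Lfun P 2%:E -> truncation X Y Z \in Lfun P 2%:E.
Proof.
move=> X2 Y2 Z2.
have mt : measurable_fun setT (truncation X Y Z).
  by apply: measurable_truncation; exact: (@Lfun2_measurable _ _ _ P).
have sum_int := integrableD measurableT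
  (integrableD measurableT (Lfun2_integrable_sqr X2) (Lfun2_integrable_sqr Y2))
  (Lfun2_integrable_sqr Z2).
apply: integrable_sqr_Lfun2 => //; apply: le_integrable sum_int => //.
  by apply/measurable_EFinP; exact: measurable_funX.
move=> w _ /=; rewrite lee_fin !ger0_norm ?addr_ge0 ?sqr_ge0//.
exact: sqr_truncation_le.
Qed.

(** The four cases, for X truncated by Y from below and by Z from above, with
    the constants c1 and c2 fixed. *)
Definition truncation_cases X Y Z c1 c2 :=
    [\/ {ae P, forall w, [/\ c2 = Z w, Z w >= X w, X w >= Y w & Y w = c1]},
        {ae P, forall w, [/\ c2 = X w, X w >= Y w & Y w = c1]} /\
        {ae P, forall w, c2 = X w /\ X w >= Z w},
        {ae P, forall w, [/\ c2 = Z w, Z w >= Y w, Y w >= X w & X w = c1]} |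
        {ae P, forall w, [/\ c2 = Y w, Y w >= X w & X w = c1]} /\
        {ae P, forall w, c2 = Y w /\ Y w >= Z w}].

(** The cases are exchanged in pairs (first with third, second with fourth)
    by the symmetry of the truncation in X and Y. *)
Lemma truncation_casesC X Y Z c1 c2 :
  truncation_cases X Y Z c1 c2 -> truncation_cases Y X Z c1 c2.
Proof.
by case=> H; [apply: Or43|apply: Or44|apply: Or41|apply: Or42].
Qed.

(** In each case the truncation is almost surely one of the variables, and
    the other two are constant. *)
Lemma truncation_cases_variance X Y Z : measurable_fun setT X ->
  measurable_fun setT Y -> measurable_fun setT Z ->
  (exists c1 c2, truncation_cases X Y Z c1 c2) ->
  'V_P[truncation X Y Z]%E = ('V_P[Z] + 'V_P[Y] + 'V_P[X])%E.
Proof.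
move=> mX mY mZ [c1 [c2]].
wlog : X Y mX mY / {ae P, forall w,
      [/\ c2 = Z w, Z w >= X w, X w >= Y w & Y w = c1]} \/
    {ae P, forall w, [/\ c2 = X w, X w >= Y w & Y w = c1]} /\
    {ae P, forall w, c2 = X w /\ X w >= Z w}.
  move=> wl; case=> H; first by apply: wl => //; [left|constructor 1].
  - by apply: wl => //; [right|constructor 2].
  - by rewrite truncationC addeAC; apply: wl => //; [left|constructor 1].
  - by rewrite truncationC addeAC; apply: wl => //; [right|constructor 2].
have mt := measurable_truncation mX mY mZ.
case=> [H _|[H H'] _].
- rewrite (variance_ae_eq (f := truncation X Y Z) (g := X))//; last first.
    apply: filterS H => w [_ ZX XY _].
    by rewrite /truncation (max_idPl XY) (min_idPr ZX).
  rewrite (variance_ae_cst (f := Z) (c := c2))//; last first.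
    by apply: filterS H => w [].
  rewrite (variance_ae_cst (f := Y) (c := c1)) ?add0e//.
  by apply: filterS H => w [].
- rewrite (variance_ae_eq (f := truncation X Y Z) (g := Z))//; last first.
    apply: filterS2 H H' => w [_ XY _] [_ XZ].
    by rewrite /truncation (max_idPl XY) (min_idPl XZ).
  rewrite (variance_ae_cst (f := X) (c := c2))//; last first.
    by apply: filterS H => w [].
  rewrite (variance_ae_cst (f := Y) (c := c1)) ?adde0//.
  by apply: filterS H => w [].
Qed.

(* The greater of X and Y is compared with Z. *)
Let cst_cases X Y Z : ae_cst P X -> ae_cst P Y -> ae_cst P Z ->
  exists c1 c2, truncation_cases X Y Z c1 c2.
Proof.
wlog : X Y / exists a b,
    [/\ b <= a, {ae P, forall w, X w = a} & {ae P, forall w, Y w = b}].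
  move=> wl [a Xa] [b Yb] Zc; have [ba|/ltW ab] := leP b a.
    by apply: wl; [exists a, b|exists a|exists b|].
  have [||||c1 [c2 H]] := wl Y X;
    [by exists b, a|by exists b|by exists a|by []|].
  by exists c1, c2; exact: truncation_casesC.
move=> [a [b [ba Xa Yb]]] _ _ [c Zc].
have [ac|/ltW ca] := leP a c.
- by exists b, c; constructor 1; apply: filterS3 Xa Yb Zc => w -> -> ->.
- exists b, a; constructor 2; split; first by apply: filterS2 Xa Yb => w -> ->.
  by apply: filterS2 Xa Zc => w -> ->.
Qed.

(** The squared difference of the truncation at almost all pairs of points
    attains the upper bound given by the sum of the three squared
    differences. *)
Definition tight X Y Z := let t := truncation X Y Z in
  {ae P, forall w, {ae P, forall w', (t w - t w') ^+ 2 =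
    (X w - X w') ^+ 2 + (Y w - Y w') ^+ 2 + (Z w - Z w') ^+ 2}}.

Let tightC X Y Z : tight X Y Z -> tight Y X Z.
Proof.
rewrite /tight /= truncationC; apply: filterS => w; apply: filterS => w' ->.
by congr (_ + _); rewrite addrC.
Qed.

Let tight_cst_YZ X Y Z : tight X Y Z -> ae_cst P Y -> ae_cst P Z ->
  exists c1 c2, truncation_cases X Y Z c1 c2.
Proof.
move=> tXYZ [y Yy] [z Zz].
have [XYZ|X_cst] : {ae P, forall w, y <= X w <= z} \/ ae_cst P X; last 2 first.
- exists y, z; constructor 1.
  by apply: filterS3 XYZ Yy Zz => w /andP[yX Xz] -> ->.
- by apply: cst_cases => //; [exists y|exists z].
apply: ae_out_cst; apply: filterS3 tXYZ (Yy) (Zz) => w tw Yw Zw.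
have [?|out] := boolP (y <= X w <= z); [by left|right].
apply: filterS3 tw Yy Zz => w' tw' Yw' Zw'.
apply: clamp_out_eq out _; move: tw'.
by rewrite /truncation Yw Zw Yw' Zw' !subrr expr0n/= !addr0.
Qed.

Let tight_cst_XY X Y Z : tight X Y Z -> ae_cst P X -> ae_cst P Y ->
  exists c1 c2, truncation_cases X Y Z c1 c2.
Proof.
move=> tXYZ [x Xx] [y Yy].
have [ZXY|Z_cst] : {ae P, forall w, Z w <= Num.max x y} \/ ae_cst P Z;
  last 2 first.
- have [yx|/ltW xy] := leP y x.
  + exists y, x; constructor 2; split.
      by apply: filterS2 Xx Yy => w -> ->.
    by apply: filterS2 ZXY Xx => w; rewrite (max_idPl yx) => Zx ->.
  + exists x, y; constructor 4; split.
      by apply: filterS2 Xx Yy => w -> ->.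
    by apply: filterS2 ZXY Yy => w; rewrite (max_idPr xy) => Zy ->.
- by apply: cst_cases => //; [exists x|exists y].
apply: ae_out_cst; apply: filterS3 tXYZ (Xx) (Yy) => w tw Xw Yw.
have [?|out] := leP (Z w) (Num.max x y); [by left|right].
apply: filterS3 tw Xx Yy => w' tw' Xw' Yw'.
apply: min_out_eq out _; move: tw'.
by rewrite /truncation Xw Yw Xw' Yw' !subrr expr0n/= !add0r.
Qed.

Lemma variance_truncation_cases X Y Z : X \in Lfun P 2%:E ->
  Y \in Lfun P 2%:E -> Z \in Lfun P 2%:E ->
  'V_P[truncation X Y Z]%E = ('V_P[Z] + 'V_P[Y] + 'V_P[X])%E ->
  exists c1 c2, truncation_cases X Y Z c1 c2.
Proof.
move=> X2 Y2 Z2 Vt.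
have tXYZ : tight X Y Z.
  apply: variance_sum_ae_pairs => //; first exact: Lfun2_truncation.
    move=> w w'.
    have := sqr_ge0 (X w - X w'); have := sqr_ge0 (Y w - Y w').
    have := sqr_ge0 (Z w - Z w').
    by have /= [] := sqr_truncationB_le X Y Z w w'; lra.
  by rewrite Vt addeC addeA addeAC.
(* The squared difference of the truncation is at most one of the three terms
   and equal to their sum, so the other two terms vanish. *)
have pairs_eq : {ae P, forall w, {ae P, forall w',
    [\/ Y w = Y w' /\ Z w = Z w', X w = X w' /\ Z w = Z w' |
        X w = X w' /\ Y w = Y w']}}.
  apply: filterS (tXYZ) => w; apply: filterS => w' eq_w.
  have sqr_eq0 (a b : R) : (a - b) ^+ 2 <= 0 -> a = b.
    by rewrite real_exprn_even_le0 ?num_real//= subr_eq0 => /eqP.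
  have := sqr_ge0 (X w - X w'); have := sqr_ge0 (Y w - Y w').
  have := sqr_ge0 (Z w - Z w').
  by have /= [] := sqr_truncationB_le X Y Z w w'; rewrite eq_w => *;
    [constructor 1|constructor 2|constructor 3];
    split; apply: sqr_eq0; lra.
have [X_cst|Y_cst] : ae_cst P X \/ ae_cst P Y.
    apply: ae_pairs_cst; apply: filterS (pairs_eq) => w; apply: filterS => w'.
    by case=> -[? ?]; [right|left|left].
- have [Y_cst|Z_cst] : ae_cst P Y \/ ae_cst P Z.
    apply: ae_pairs_cst; apply: filterS (pairs_eq) => w; apply: filterS => w'.
    by case=> -[? ?]; [left|right|left].
  + exact: tight_cst_XY.
  + have [c1 [c2 H]] := tight_cst_YZ (tightC tXYZ) X_cst Z_cst.
    by exists c1, c2; exact: truncation_casesC.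
- have [X_cst|Z_cst] : ae_cst P X \/ ae_cst P Z.
    apply: ae_pairs_cst; apply: filterS (pairs_eq) => w; apply: filterS => w'.
    by case=> -[? ?]; [right|left|left].
  + exact: tight_cst_XY.
  + exact: tight_cst_YZ.
Qed.

End truncation_probability.

Theorem theorem4 (d : measure_display) (T : measurableType d) (R : realType)
    (P : probability T R) (X X1 X2 : {RV P >-> R})
    (hX : (X : T -> R) \in Lfun P 2%:E)
    (hX1 : (X1 : T -> R) \in Lfun P 2%:E)
    (hX2 : (X2 : T -> R) \in Lfun P 2%:E) :
  ('V_P[truncation X X1 X2] = 'V_P[X2] + 'V_P[X1] + 'V_P[X])%E <->
  exists c1 c2 : R,
    [\/ {ae P, forall w, [/\ c2 = X2 w, X2 w >= X w, X w >= X1 w & X1 w = c1]},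
        {ae P, forall w, [/\ c2 = X w, X w >= X1 w & X1 w = c1]} /\
        {ae P, forall w, c2 = X w /\ X w >= X2 w},
        {ae P, forall w, [/\ c2 = X2 w, X2 w >= X1 w, X1 w >= X w & X w = c1]} |
        {ae P, forall w, [/\ c2 = X1 w, X1 w >= X w & X w = c1]} /\
        {ae P, forall w, c2 = X1 w /\ X1 w >= X2 w}].
Proof.
split; first exact: variance_truncation_cases.
by apply: truncation_cases_variance.
Qed.
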